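(* Let $G=(I_1,I_2,I_3,E(G))$ be a tripartite graph with $n$ vertices and $m>\frac{n^2}{4}$ edges. Then $\tau(G)\le \frac{n^2}{3(4m-n^2)}\cdot\nu(G)$.
   Context: A tripartite graph $G=(I_1,I_2,I_3,E(G))$ is a graph whose vertex set is partitioned into three independent sets $I_1,I_2,I_3$. $\tau(G)$ is the minimum size of a set of edges whose removal leaves a triangle-free graph, and $\nu(G)$ is the maximum number of pairwise edge-disjoint triangles in $G$. *)

(* Defs.v *)
From mathcomp Require Import all_boot all_order all_algebra.
Set Implicit Arguments.
Unset Strict Implicit.
Unset Printing Implicit Defensive.

(* A finite simple graph on the vertex type T is a symmetric irreflexive
   adjacency relation e : rel T. *)

(* An edge is the unordered pair of its endpoints. *)
Definition edges (T : finType) (e : rel T) : {set {set T}} :=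
  [set f : {set T} | [exists x, exists y, e x y && (f == [set x; y])]].

Definition independent (T : finType) (e : rel T) (A : {set T}) : bool :=
  [forall x in A, forall y in A, ~~ e x y].

(* The parts are allowed to be empty. *)
Definition tripartition (T : finType) (e : rel T) (I1 I2 I3 : {set T}) : Prop :=
  [/\ I1 :|: I2 :|: I3 = [set: T],
      [/\ [disjoint I1 & I2], [disjoint I1 & I3] & [disjoint I2 & I3]]
    & [/\ independent e I1, independent e I2 & independent e I3]].

(* In a simple graph a triangle is determined by its vertex set. *)
Definition triangles (T : finType) (e : rel T) : {set {set T}} :=
  [set t : {set T} | (#|t| == 3) &&
     [forall x in t, forall y in t, (x != y) ==> e x y]].

Definition triangle_free (T : finType) (e : rel T) : bool :=
  triangles e == set0.

Definition remove_edges (T : finType) (e : rel T) (F : {set {set T}}) : rel T :=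
  fun x y => e x y && ([set x; y] \notin F).

Definition triangle_cover (T : finType) (e : rel T) (F : {set {set T}}) : bool :=
  (F \subset edges e) && triangle_free (remove_edges e F).

(* [arg min_] starts from the set of all edges, which is always a
   triangle_cover by triangle_cover_edges. *)
Definition tau (T : finType) (e : rel T) : nat :=
  #|[arg min_(F < edges e | triangle_cover e F) #|F|]|.

Definition edges_in (T : finType) (e : rel T) (t : {set T}) : {set {set T}} :=
  [set f in edges e | f \subset t].

Definition triangle_packing (T : finType) (e : rel T) (P : {set {set T}}) : bool :=
  (P \subset triangles e) &&
  [forall t1 in P, forall t2 in P,
     (t1 != t2) ==> [disjoint edges_in e t1 & edges_in e t2]].

Definition nu (T : finType) (e : rel T) : nat :=
  \max_(P : {set {set T}} | triangle_packing e P) #|P|.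

Lemma triangle_cover_edges (T : finType) (e : rel T) :
  triangle_cover e (edges e).
Proof.
rewrite /triangle_cover subxx /=; apply/eqP/setP=> t; rewrite !inE.
apply/negP=> /andP[/eqP t3 /forall_inP tri].
have /card_gt1P[x [y [xt yt xy]]] : 1 < #|t| by rewrite t3.
have := forall_inP (tri x xt) y yt.
rewrite xy /remove_edges /= => /andP[exy]; rewrite inE => /negP; apply.
by apply/existsP; exists x; apply/existsP; exists y; rewrite exy eqxx.
Qed.

Lemma tauP (T : finType) (e : rel T) :
  (exists2 F : {set {set T}}, triangle_cover e F & #|F| = tau e) /\
  (forall F : {set {set T}}, triangle_cover e F -> tau e <= #|F|).
Proof.
rewrite /tau; case: arg_minnP => [|F cF minF]; first exact: triangle_cover_edges.
by split=> //; exists F.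
Qed.

(* Main.v *)
Require Import Defs.
From mathcomp Require Import all_boot all_order all_algebra.
From mathcomp Require Import zify lra.

(* Let A be a largest part, with a >= b, c the sizes of the parts, and let
   S = b + c. A Latin rectangle g : B x C -> A yields bc edge-disjoint triangles
   {u, v, g u v} of the complete tripartite graph, and each non-edge of G lies
   in at most one of them, so nu >= m - aS. On the other hand tau is at most
   the number of edges between any two parts, so tau <= m / 3 and tau <= bc.
   It remains to see that 3 (4m - n^2) tau <= n^2 (m - aS). Put
   M = max(a, S). If 2m <= nM, this follows from tau <= m / 3, because
   n^2 (m - aS) - (4m - n^2) m = (2m - na) (nS - 2m).
   Otherwise tau <= bc suffices: the inequality is then affine in m, and holds
   at both ends of the range nM / 2 <= m <= aS + bc. *)

Set Implicit Arguments.
Unset Strict Implicit.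
Unset Printing Implicit Defensive.
Import Order.TTheory GRing.Theory Num.Theory.

(** * Edges, triangles and bipartite graphs *)

Lemma independentP (T : finType) (e : rel T) (A : {set T}) :
  reflect {in A &, forall x y, ~~ e x y} (independent e A).
Proof.
apply: (iffP forall_inP) => [h x y xA yA | h x xA].
  by apply: (forall_inP (h x xA)).
by apply/forall_inP => y yA; apply: h.
Qed.

Lemma edgesP (T : finType) (e : rel T) (f : {set T}) :
  reflect (exists x y, e x y /\ f = [set x; y]) (f \in edges e).
Proof.
rewrite inE; apply: (iffP existsP) => [[x /existsP[y /andP[exy /eqP]]]|[x [y [exy ->]]]].
  by exists x, y.
by exists x; apply/existsP; exists y; rewrite exy eqxx.
Qed.

Lemma trianglesP (T : finType) (e : rel T) (t : {set T}) :
  reflect (#|t| = 3 /\ {in t &, forall x y, x != y -> e x y}) (t \in triangles e).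
Proof.
rewrite inE; apply: (iffP andP) => [[/eqP t3 /forall_inP h]|[t3 h]]; split=> //.
- by move=> x y xt yt; apply/implyP; apply: (forall_inP (h x xt)).
- by rewrite t3.
- by apply/forall_inP=> x xt; apply/forall_inP=> y yt; apply/implyP/h.
Qed.

(** Pigeonhole: two of the three vertices of a triangle lie on the same side, yet they are
    adjacent. *)
Lemma bipartite_triangle_free (T : finType) (e : rel T) (A B : {set T}) :
  A :|: B = [set: T] -> independent e A -> independent e B -> triangle_free e.
Proof.
move=> AB /independentP iA /independentP iB.
rewrite /triangle_free -subset0; apply/subsetP=> t /trianglesP[t3 adj].
have /card_gt2P[x [y [z [[xt yt zt] [xy yz zx]]]]] : 2 < #|t| by rewrite t3.
have inAB w : (w \in A) || (w \in B) by rewrite -in_setU AB inE.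
have exy := adj _ _ xt yt xy; have eyz := adj _ _ yt zt yz.
have ezx := adj _ _ zt xt zx.
have nAA u v : e u v -> u \in A -> v \in A = false.
  by move=> euv uA; apply/negP=> vA; rewrite (negPf (iA _ _ uA vA)) in euv.
have nBB u v : e u v -> u \in B -> v \in B = false.
  by move=> euv uB; apply/negP=> vB; rewrite (negPf (iB _ _ uB vB)) in euv.
case/orP: (inAB x) => hx; case/orP: (inAB y) => hy; case/orP: (inAB z) => hz.
all: by [move: (nAA _ _ exy hx); rewrite hy | move: (nAA _ _ eyz hy); rewrite hz
  | move: (nAA _ _ ezx hz); rewrite hx | move: (nBB _ _ exy hx); rewrite hy
  | move: (nBB _ _ eyz hy); rewrite hz | move: (nBB _ _ ezx hz); rewrite hx].
Qed.

(** * Counting edges between two parts *)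

(** Ordered pairs make comparison with the product of the part sizes immediate; for disjoint parts
    they are as many as the unordered edges. *)
Definition adj_pairs (T : finType) (e : rel T) (A B : {set T}) : {set T * T} :=
  [set p in setX A B | e p.1 p.2].

Definition edges_between (T : finType) (e : rel T) (A B : {set T}) : {set {set T}} :=
  [set [set p.1; p.2] | p in adj_pairs e A B].

Lemma edges_betweenP (T : finType) (e : rel T) (A B : {set T}) (f : {set T}) :
  reflect (exists x y, [/\ x \in A, y \in B, e x y & f = [set x; y]])
    (f \in edges_between e A B).
Proof.
apply: (iffP imsetP) => [[[x y] /=]|[x [y [xA yB exy ->]]]].
  by rewrite !inE /= => /andP[/andP[xA yB] exy] ->; exists x, y.
by exists (x, y); rewrite // !inE xA yB.
Qed.

Section Tripartite.

Variables (T : finType) (e : rel T).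
Hypothesis e_sym : symmetric e.
Implicit Types A B C : {set T}.

Lemma tripartition_rot A B C : tripartition e A B C -> tripartition e B C A.
Proof.
case=> U [dAB dAC dBC] [iA iB iC]; split=> //.
  by rewrite -U setUC setUA.
by split=> //; rewrite disjoint_sym.
Qed.

Lemma edges_betweenC A B : edges_between e A B = edges_between e B A.
Proof.
by apply/setP=> f; apply/edges_betweenP/edges_betweenP => -[x [y [xA yB exy ->]]];
  exists y, x; rewrite e_sym setUC.
Qed.

Lemma card_edges_between A B :
  [disjoint A & B] -> #|edges_between e A B| = #|adj_pairs e A B|.
Proof.
move=> dAB; apply: card_in_imset => -[x y] [x' y'] /=.
rewrite !inE /= => /andP[/andP[xA yB] _] /andP[/andP[x'A y'B] _] E.
have neq u v : u \in A -> v \in B -> u == v = false.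
  by move=> uA vB; apply/eqP=> uv; rewrite -uv (disjointFr dAB uA) in vB.
have : x \in [set x'; y'] by rewrite -E set21.
have : y \in [set x'; y'] by rewrite -E set22.
by rewrite !inE (neq x y') // [y == x']eq_sym (neq x' y) // orbF => /eqP-> /eqP->.
Qed.

Lemma card_adj_pairs A B : #|adj_pairs e A B| <= #|A| * #|B|.
Proof. by rewrite -cardsX subset_leq_card //; apply/subsetP=> p; rewrite inE => /andP[]. Qed.

(** A common edge would have an endpoint in [C], but both its endpoints lie in [A] or [B]. *)
Lemma edges_between_disjoint A B C D : [disjoint C & A] -> [disjoint C & B] ->
  [disjoint edges_between e A B & edges_between e C D].
Proof.
move=> CA CB; rewrite -setI_eq0 -subset0; apply/subsetP=> f; rewrite inE.
case/andP=> /edges_betweenP[x [y [xA yB _ ->]]] /edges_betweenP[z [w [zC _ _ E]]].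
have : z \in [set x; y] by rewrite E set21.
rewrite !inE => /orP[]/eqP zE; subst z.
  by rewrite (disjointFr CA zC) in xA.
by rewrite (disjointFr CB zC) in yB.
Qed.

Lemma edges_tripartite A B C : tripartition e A B C ->
  edges e = edges_between e A B :|: edges_between e B C :|: edges_between e C A.
Proof.
case=> U _ [/independentP iA /independentP iB /independentP iC].
apply/setP=> f; rewrite !in_setU; apply/edgesP/idP => [[x [y [exy ->]]]|]; last first.
  by case/orP=> [/orP[]|] /edges_betweenP[x [y [_ _ exy ->]]]; exists x, y.
have inU w : [|| w \in A, w \in B | w \in C].
  by rewrite orbA -!in_setU U inE.
have bet A' B' : x \in A' -> y \in B' -> [set x; y] \in edges_between e A' B'.
  by move=> xA yB; apply/edges_betweenP; exists x, y.
case/or3P: (inU x) => hx; case/or3P: (inU y) => hy.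
- by rewrite (negPf (iA _ _ hx hy)) in exy.
- by rewrite bet.
- by rewrite [edges_between e C A]edges_betweenC (bet A C) ?orbT.
- by rewrite [edges_between e A B]edges_betweenC (bet B A) ?orbT.
- by rewrite (negPf (iB _ _ hx hy)) in exy.
- by rewrite (bet B C) ?orbT.
- by rewrite (bet C A) ?orbT.
- by rewrite [edges_between e B C]edges_betweenC (bet C B) ?orbT.
- by rewrite (negPf (iC _ _ hx hy)) in exy.
Qed.

Lemma card_edges_tripartite A B C : tripartition e A B C ->
  #|edges e| = #|adj_pairs e A B| + #|adj_pairs e B C| + #|adj_pairs e C A|.
Proof.
move=> tri; have [_ [dAB dAC dBC] _] := tri.
rewrite (edges_tripartite tri) !cardsU.
have -> : edges_between e A B :&: edges_between e B C = set0.
  by apply/eqP; rewrite setI_eq0 [edges_between e B C]edges_betweenC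
    edges_between_disjoint // disjoint_sym.
have -> : (edges_between e A B :|: edges_between e B C) :&: edges_between e C A = set0.
  apply/eqP; rewrite setIUl setU_eq0 !setI_eq0; apply/andP; split.
    by apply: edges_between_disjoint; rewrite disjoint_sym.
  by rewrite [edges_between e C A]edges_betweenC edges_between_disjoint.
by rewrite cards0 !subn0 !card_edges_between // disjoint_sym.
Qed.

(** Deleting all edges between [A] and [B] leaves a bipartite graph with sides [A :|: B] and [C]. *)
Lemma tau_le_between A B C : tripartition e A B C -> tau e <= #|adj_pairs e A B|.
Proof.
case=> U [dAB dAC dBC] [/independentP iA /independentP iB /independentP iC].
rewrite -card_edges_between //; apply: (tauP e).2; apply/andP; split.
  by apply/subsetP=> f /edges_betweenP[x [y [_ _ exy ->]]]; apply/edgesP; exists x, y.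
apply: bipartite_triangle_free U _ _; apply/independentP => x y xP yP; last first.
  by rewrite /remove_edges negb_and iC.
rewrite /remove_edges negb_and negbK -implybE; apply/implyP => exy.
move: xP yP; rewrite !inE => /orP[]hx /orP[]hy.
- by rewrite (negPf (iA _ _ hx hy)) in exy.
- by apply/edges_betweenP; exists x, y.
- by rewrite edges_betweenC; apply/edges_betweenP; exists x, y.
- by rewrite (negPf (iB _ _ hx hy)) in exy.
Qed.

End Tripartite.

(** * A triangle packing from a Latin rectangle *)

(** The cyclic rectangle: number the elements of each set and add indices modulo [#|A|]. Since [B]
    and [C] are no larger than [A], their indices are already reduced, so cancelling one summand
    gives injectivity. Reduction modulo [#|A|] puts every value in [A], even for arguments outside
    [B] and [C]. *)
Lemma latin_rectangle (T : finType) (A B C : {set T}) :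
  0 < #|A| -> #|B| <= #|A| -> #|C| <= #|A| ->
  exists g : T -> T -> T, [/\ forall u v, g u v \in A,
    forall u, {in C &, injective (g u)} & forall v, {in B &, injective (g^~ v)}].
Proof.
move=> A0 BA CA; have /card_gt0P[x0 _] := A0.
pose g u v := nth x0 (enum A) ((index u (enum B) + index v (enum C)) %% #|A|).
have lt u v : (index u (enum B) + index v (enum C)) %% #|A| < size (enum A).
  by rewrite -cardE ltn_mod.
have lti (D : {set T}) x : #|D| <= #|A| -> x \in D -> index x (enum D) < #|A|.
  by move=> DA xD; apply: leq_trans DA; rewrite cardE index_mem mem_enum.
have idx_inj (D : {set T}) : {in D &, injective (index^~ (enum D))}.
  by move=> x y xD yD /(congr1 (nth x0 (enum D))); rewrite !nth_index ?mem_enum.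
exists g; split=> [u v | u v v' vC v'C | v u u' uB u'B].
- by rewrite -mem_enum mem_nth.
- move/eqP; rewrite nth_uniq ?enum_uniq // eqn_modDl !modn_small ?lti // => /eqP.
  exact: idx_inj.
- move/eqP; rewrite nth_uniq ?enum_uniq // eqn_modDr !modn_small ?lti // => /eqP.
  exact: idx_inj.
Qed.

Lemma card_nonadj_pairs (T : finType) (e : rel T) (A B : {set T}) :
  #|[set p in setX A B | ~~ e p.1 p.2]| + #|adj_pairs e A B| = #|A| * #|B|.
Proof.
rewrite -cardsX -(cardsID [set p | e p.1 p.2] (setX A B)) addnC; congr (_ + _).
  by apply: eq_card => p; rewrite !inE.
by apply: eq_card => p; rewrite !inE andbC.
Qed.

(** Of the [#|B| * #|C|] triangles of the rectangle, each missing edge of the graph destroys at most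
    one; the survivors form a packing. The bound is written additively to avoid truncated
    subtraction. *)
Lemma nu_tripartite (T : finType) (e : rel T) (e_sym : symmetric e)
    (e_irr : irreflexive e) (A B C : {set T}) : tripartition e A B C ->
  0 < #|A| -> #|B| <= #|A| -> #|C| <= #|A| ->
  #|edges e| <= nu e + #|A| * (#|B| + #|C|).
Proof.
move=> tri A0 BA CA; have [_ [dAB dAC dBC] [iA iB iC]] := tri.
have [g [gA gC gB]] := latin_rectangle A0 BA CA.
have AB x y : x \in A -> y \in B -> x == y = false.
  by move=> xA yB; apply/eqP=> xy; rewrite -xy (disjointFr dAB xA) in yB.
have AC x y : x \in A -> y \in C -> x == y = false.
  by move=> xA yC; apply/eqP=> xy; rewrite -xy (disjointFr dAC xA) in yC.
have BC x y : x \in B -> y \in C -> x == y = false.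
  by move=> xB yC; apply/eqP=> xy; rewrite -xy (disjointFr dBC xB) in yC.
pose t (p : T * T) := [set p.1; p.2; g p.1 p.2].
pose good := [set p in setX B C | [&& e p.1 p.2, e p.1 (g p.1 p.2) & e p.2 (g p.1 p.2)]].
(* The parts are disjoint, so a vertex shared by two of these triangles occupies the same position
   in both. *)
have common p q x : p \in setX B C -> q \in setX B C -> x \in t p -> x \in t q ->
    [\/ x = p.1 /\ p.1 = q.1, x = p.2 /\ p.2 = q.2
      | x = g p.1 p.2 /\ g p.1 p.2 = g q.1 q.2].
  rewrite !inE => /andP[p1 p2] /andP[q1 q2] /orP[/orP[]|] /eqP->.
  - rewrite (BC _ _ p1 q2) orbF (eq_sym p.1 (g _ _)) (AB _ _ (gA _ _) p1) orbF.
    by move/eqP; constructor 1.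
  - rewrite (eq_sym p.2 q.1) (BC _ _ q1 p2) /= (eq_sym p.2 (g _ _)) (AC _ _ (gA _ _) p2) orbF.
    by move/eqP; constructor 2.
  - by rewrite (AB _ _ (gA _ _) q1) (AC _ _ (gA _ _) q2) /= => /eqP; constructor 3.
have t_inj : {in setX B C &, injective t}.
  move=> p q pX qX tE; have := pX; have := qX; rewrite !inE => /andP[q1 q2] /andP[p1 p2].
  have e1 : p.1 = q.1.
    have p1t : p.1 \in t p by rewrite !inE eqxx.
    have p1q : p.1 \in t q by rewrite -tE.
    have [[//]|[]pE|[]pE] := common p q p.1 pX qX p1t p1q.
      by move: (BC _ _ p1 p2); rewrite -pE eqxx.
    by move: (AB _ _ (gA p.1 p.2) p1); rewrite -pE eqxx.
  have e2 : p.2 = q.2.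
    have p2t : p.2 \in t p by rewrite !inE eqxx orbT.
    have p2q : p.2 \in t q by rewrite -tE.
    have [[]pE|[//]|[]pE] := common p q p.2 pX qX p2t p2q.
      by move: (BC _ _ p1 p2); rewrite -pE eqxx.
    by move: (AC _ _ (gA p.1 p.2) p2); rewrite -pE eqxx.
  by rewrite (surjective_pairing p) (surjective_pairing q) e1 e2.
have goodX p : p \in good -> p \in setX B C by rewrite inE => /andP[].
have packing : triangle_packing e (t @: good).
  apply/andP; split.
    apply/subsetP=> _ /imsetP[p pG ->]; have := pG; rewrite 2!inE.
    case/andP=> /andP[p1 p2] /and3P[e12 e1g e2g].
    apply/trianglesP; split.
      rewrite /t -setUA !cardsU1 cards1 !inE (BC _ _ p1 p2).
      by rewrite (eq_sym p.1) (AB _ _ (gA _ _) p1) (eq_sym p.2) (AC _ _ (gA _ _) p2).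
    move=> x y; rewrite !inE => /orP[/orP[]|]/eqP-> /orP[/orP[]|]/eqP->;
      rewrite ?eqxx // => _; by rewrite // e_sym.
  apply/forall_inP=> _ /imsetP[p /goodX pX ->].
  apply/forall_inP=> _ /imsetP[q /goodX qX ->]; apply/implyP.
  (* A shared edge makes two of the three coordinates [u], [v], [g u v] agree, and by the Latin
     property any two of them determine the pair. *)
  apply: contraNT; rewrite -setI_eq0 => /set0Pn[f].
  case/setIP=> /setIdP[fe fp] /setIdP[_ fq].
  have [x [y [exy fE]]] := edgesP _ _ fe.
  have xf : x \in f by rewrite fE set21.
  have yf : y \in f by rewrite fE set22.
  have nxy : x <> y by move=> xy; rewrite xy e_irr in exy.
  have := common p q x pX qX (subsetP fp _ xf) (subsetP fq _ xf).
  have := common p q y pX qX (subsetP fp _ yf) (subsetP fq _ yf).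
  have := pX; have := qX; rewrite !inE => /andP[q1 q2] /andP[p1 p2] cy cx.
  suff -> : p = q by [].
  move: p q {pX qX fp fq} p1 p2 q1 q2 cx cy => [u v] [u' v'] /= uB vC u'B v'C.
  case=> -[xE e1] [] [yE e2]; try by case: nxy; rewrite xE yE.
  - by rewrite e1 e2.
  - by subst; rewrite (gC _ _ _ vC v'C e2).
  - by rewrite e1 e2.
  - by subst; rewrite (gB _ _ _ uB u'B e2).
  - by subst; rewrite (gC _ _ _ vC v'C e1).
  - by subst; rewrite (gB _ _ _ uB u'B e1).
have nu_good : #|good| <= nu e.
  rewrite -(card_in_imset (f := t)); first exact: leq_bigmax_cond packing.
  by move=> p q /goodX pX /goodX qX; apply: t_inj.
pose nonadj A' B' := [set p in setX A' B' | ~~ e p.1 p.2].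
(* A pair that is not good has a non-adjacent pair among the three sides of its triangle. *)
have bad_le : #|setX B C| <= #|good| + #|nonadj B C| + #|nonadj A B| + #|nonadj C A|.
  pose bad1 := [set p in setX B C | ~~ e p.1 (g p.1 p.2)].
  pose bad2 := [set p in setX B C | ~~ e p.2 (g p.1 p.2)].
  have le1 : #|bad1| <= #|nonadj A B|.
    (* The missing side determines the triangle: [u] and [g u v] recover [v]. *)
    rewrite -(card_in_imset (f := fun p => (g p.1 p.2, p.1))).
      apply/subset_leq_card/subsetP=> _ /imsetP[p pB ->]; move: pB.
      by rewrite !inE /= gA e_sym => /andP[/andP[-> _] ->].
    move=> [u v] [u' v']; rewrite !inE /= => /andP[/andP[_ p2] _] /andP[/andP[_ q2] _].
    by case=> gE uE; subst; rewrite (gC _ _ _ _ _ gE).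
  have le2 : #|bad2| <= #|nonadj C A|.
    rewrite -(card_in_imset (f := fun p => (p.2, g p.1 p.2))).
      apply/subset_leq_card/subsetP=> _ /imsetP[p pB ->]; move: pB.
      by rewrite !inE /= gA => /andP[/andP[_ ->] ->].
    move=> [u v] [u' v']; rewrite !inE /= => /andP[/andP[p1 _] _] /andP[/andP[q1 _] _].
    by case=> vE gE; subst; rewrite (gB _ _ _ _ _ gE).
  apply: (@leq_trans #|good :|: nonadj B C :|: bad1 :|: bad2|).
    apply/subset_leq_card/subsetP=> p pX; rewrite inE in pX.
    by rewrite !inE pX /=; do 3 case: (e _ _).
  have := (leq_card_setU (good :|: nonadj B C :|: bad1) bad2).1.
  have := (leq_card_setU (good :|: nonadj B C) bad1).1.
  have := (leq_card_setU good (nonadj B C)).1.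
  lia.
have := card_nonadj_pairs e A B; have := card_nonadj_pairs e B C.
have := card_nonadj_pairs e C A; rewrite (card_edges_tripartite e_sym tri).
rewrite cardsX in bad_le; rewrite -!/(nonadj _ _); nia.
Qed.

(** * The inequality over an ordered field *)

Local Open Scope ring_scope.

Lemma ler_interp (R : realFieldType) (k l u v w : R) :
  u <= v -> v <= w -> 0 <= k * u + l -> 0 <= k * w + l -> 0 <= k * v + l.
Proof.
move=> uv vw fu fw; have [k0|k0] := lerP 0 k.
  by apply: le_trans fu _; rewrite lerD2r ler_wpM2l.
by apply: le_trans fw _; rewrite lerD2r ler_wnM2l // ltW.
Qed.

Lemma cover_packing_ineq (R : realFieldType) (a b c m t : R) :
  0 <= b -> 0 <= c -> b <= a -> c <= a -> 0 <= t ->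
  (a + b + c) ^+ 2 < 4 * m -> m <= a * (b + c) + b * c ->
  3 * t <= m -> t <= b * c ->
  3 * (4 * m - (a + b + c) ^+ 2) * t <= (a + b + c) ^+ 2 * (m - a * (b + c)).
Proof.
move=> b0 c0 ba ca t0; set n := a + b + c; set s := b + c => mn mle t3 tbc.
have nE : n = a + s by rewrite /n /s addrA.
(* Only the sum and product of [a] and [s] matter in what follows, so they are replaced by their
   maximum [M] and minimum [M']. *)
have [M [M' [MM' aM sM nM MM]]] : exists M M' : R,
  [/\ M' <= M, a <= M, s <= M, n = M + M' & a * s = M * M'].
  have [as_|sa] := lerP a s; [exists s, a | exists a, s]; split => //.
  - by rewrite nE addrC.
  - by rewrite mulrC.
  - exact: ltW.
  - exact: ltW.
have n0 : 0 <= n by rewrite /n; lra.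
have d0 : 0 <= 4 * m - n ^+ 2 by lra.
have [small|big] := lerP (2 * m) (n * M).
  have h1 : (4 * m - n ^+ 2) * (3 * t) <= (4 * m - n ^+ 2) * m by rewrite ler_wpM2l.
  (* The second factor is nonnegative because [2 * m > n ^+ 2 / 2] and [M' <= n / 2]. The product
     equals [n ^+ 2 * (m - M * M') - (4 * m - n ^+ 2) * m]. *)
  have h2 : 0 <= (n * M - 2 * m) * (2 * m - n * M').
    by apply: mulr_ge0; [lra | rewrite nM in mn *; nra].
  rewrite MM; rewrite nM in h1 h2 *; nra.
have h1 : (4 * m - n ^+ 2) * (3 * t) <= (4 * m - n ^+ 2) * (3 * (b * c)).
  by rewrite ler_wpM2l //; lra.
(* The difference of the two sides with [t] replaced by [b * c], arranged as an affine function of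
   [m]. *)
suff h2 : 0 <= (n ^+ 2 - 12 * (b * c)) * m + (3 * n ^+ 2 * (b * c) - n ^+ 2 * (a * s)).
  nra.
apply: (@ler_interp _ _ _ (n * M / 2) _ (a * s + b * c)) => //; first by lra.
- rewrite MM.
  (* [n * s = a * b + a * c + (b + c) ^+ 2], where each of the first two terms is at least [b * c]
     and the square at least [4 * (b * c)]. *)
  have h3 : 6 * (b * c) <= n * M.
    have : n * s <= n * M by rewrite ler_wpM2l.
    suff : 6 * (b * c) <= n * s by lra.
    have h4 : b * c <= a * c by rewrite ler_wpM2r.
    have h5 : c * b <= a * b by rewrite ler_wpM2r.
    have := sqr_ge0 (b - c); rewrite /n /s; lra.
  (* Twice the value at the left endpoint. *)
  suff : 0 <= (M - M') * n * (n * M - 6 * (b * c)).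
    by clearbody n s; rewrite nM; lra.
  by rewrite !mulr_ge0 ?subr_ge0.
(* The value at the right endpoint; it is nonnegative since [n ^+ 2] is at least
   [3 * (a * b + b * c + c * a)]. *)
- suff h3 : 0 <= (b * c) * (4 * n ^+ 2 - 12 * (a * s + b * c)).
    by clearbody n s; lra.
  rewrite mulr_ge0 ?mulr_ge0 //.
  have := sqr_ge0 (a - b); have := sqr_ge0 (b - c); have := sqr_ge0 (a - c).
  rewrite /n /s; lra.
Qed.

(** * From the inequality to the graph *)

Lemma tripartition_card (T : finType) (e : rel T) (A B C : {set T}) :
  tripartition e A B C -> #|T| = (#|A| + #|B| + #|C|)%N.
Proof.
case=> U [dAB dAC dBC] _; rewrite -cardsT -U !cardsU setIUl.
move: dAB dAC dBC; rewrite -!setI_eq0 => /eqP-> /eqP-> /eqP->.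
by rewrite setU0 cards0 !subn0.
Qed.

Lemma tau_nu_largest_part (T : finType) (e : rel T)
    (e_sym : symmetric e) (e_irr : irreflexive e) (A B C : {set T}) :
  tripartition e A B C -> (#|B| <= #|A|)%N -> (#|C| <= #|A|)%N ->
  #|T|%:R ^+ 2 < 4 * #|edges e|%:R :> rat ->
  3 * (4 * #|edges e|%:R - #|T|%:R ^+ 2) * (tau e)%:R
    <= #|T|%:R ^+ 2 * (nu e)%:R :> rat.
Proof.
move=> tri BA CA; have triB := tripartition_rot tri; have triC := tripartition_rot triB.
have := tau_le_between e_sym tri; have := tau_le_between e_sym triB.
have := tau_le_between e_sym triC; have := card_edges_tripartite e_sym tri.
have := card_adj_pairs e A B; have := card_adj_pairs e B C; have := card_adj_pairs e C A.
rewrite (tripartition_card tri) => leCA leBC leAB mE tCA tBC tAB mn.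
(* If the largest part were empty there would be no edges, against the density hypothesis. *)
have A0 : (0 < #|A|)%N.
  rewrite lt0n; apply/eqP=> a0; have m0 : #|edges e| = 0%N by nia.
  by move: mn; rewrite m0 mulr0 ltNge sqr_ge0.
have nuE := nu_tripartite e_sym e_irr tri A0 BA CA.
have nu_ge : #|edges e|%:R - #|A|%:R * (#|B|%:R + #|C|%:R) <= (nu e)%:R :> rat.
  by rewrite lerBlDr -natrD -natrM -natrD ler_nat.
rewrite !natrD in mn *.
apply: le_trans (ler_wpM2l (sqr_ge0 _) nu_ge).
apply: cover_packing_ineq; rewrite ?ler0n ?ler_nat //.
- by rewrite -!natrD -!natrM -natrD ler_nat; nia.
- by rewrite -natrM ler_nat; lia.
- by rewrite -natrM ler_nat; lia.
Qed.

Theorem theorem2 (T : finType) (e : rel T)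
    (e_sym : symmetric e) (e_irr : irreflexive e)
    (I1 I2 I3 : {set T}) (e_tri : tripartition e I1 I2 I3)
    (n m : nat) (hn : #|T| = n) (hm : #|edges e| = m)
    (hmn : n%:R ^+ 2 / 4 < m%:R :> rat) :
  (tau e)%:R <= n%:R ^+ 2 / (3 * (4 * m%:R - n%:R ^+ 2)) * (nu e)%:R :> rat.
Proof.
have mn : #|T|%:R ^+ 2 < 4 * #|edges e|%:R :> rat by rewrite hn hm; lra.
suff : 3 * (4 * m%:R - n%:R ^+ 2) * (tau e)%:R <= n%:R ^+ 2 * (nu e)%:R :> rat.
  by move=> h; rewrite mulrAC ler_pdivlMr; [rewrite mulrC | lra].
rewrite -hn -hm; have tri2 := tripartition_rot e_tri; have tri3 := tripartition_rot tri2.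
(* Rotate the parts cyclically so that a largest one comes first. *)
have [h12|h12] := leqP #|I2| #|I1|; have [h13|h13] := leqP #|I3| #|I1|.
- exact: (tau_nu_largest_part e_sym e_irr e_tri).
- by apply: (tau_nu_largest_part e_sym e_irr tri3); lia.
- by apply: (tau_nu_largest_part e_sym e_irr tri2); lia.
- have [h23|h23] := leqP #|I3| #|I2|.
    by apply: (tau_nu_largest_part e_sym e_irr tri2); lia.
  by apply: (tau_nu_largest_part e_sym e_irr tri3); lia.
Qed.
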